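(* Let $(s_n)_{n\ge 0}$ be the little Schröder numbers. For all integers $n,k$ with $1\le k<n$, \[ B_{n,k}(1!s_0,2!s_1,3!s_2,\dots)=\frac{n!}{(k-1)!}\sum_{j=1}^{n-k}\frac{1}{j}\binom{n-k-1}{j-1}\binom{n+j-1}{j-1}. \]
   Context: A Schröder path is a lattice path with steps $\mathsf{E}=(1,0)$, $\mathsf{N}=(0,1)$, $\mathsf{D}=(1,1)$ that stays weakly above the line $y=x$. The little Schröder number $s_n$ ($n\ge 0$) is the number of Schröder paths from $(0,0)$ to $(n,n)$ having no $\mathsf{D}$-step on the line $y=x$; so $s_0=1,s_1=1,s_2=3,s_3=11,s_4=45,\dots$. For $0\le k\le n$, the (exponential) partial Bell polynomial is \[B_{n,k}(z_1,z_2,\dots)=\sum_{\alpha}\frac{n!}{\alpha_1!\alpha_2!\cdots}\Big(\frac{z_1}{1!}\Big)^{\alpha_1}\Big(\frac{z_2}{2!}\Big)^{\alpha_2}\cdots,\] the sum over all $\alpha=(\alpha_1,\dots,\alpha_{n-k+1})\in\mathbb{N}_0^{n-k+1}$ with $\alpha_1+\alpha_2+\cdots=k$ and $\alpha_1+2\alpha_2+3\alpha_3+\cdots=n$. *)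

(* Defs.v *)
From HB Require Import structures.
From mathcomp Require Import all_boot all_order all_algebra.

Set Implicit Arguments.
Unset Strict Implicit.
Unset Printing Implicit Defensive.

Import Order.TTheory GRing.Theory Num.Theory.

Inductive step : predArgType := E | N | D.

Definition ord_of_step (s : step) : 'I_3 :=
  match s with E => inord 0 | N => inord 1 | D => inord 2 end.

Definition step_of_ord (i : 'I_3) : step :=
  match val i with 0 => E | 1 => N | _ => D end.

Lemma ord_of_stepK : cancel ord_of_step step_of_ord.
Proof. by case; rewrite /step_of_ord /= inordK. Qed.

HB.instance Definition _ := Countable.copy step (can_type ord_of_stepK).
HB.instance Definition _ := isFinite.Build step (pcan_enumP (can_pcan ord_of_stepK)).

Definition dx (s : step) : nat := match s with E => 1 | N => 0 | D => 1 end.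
Definition dy (s : step) : nat := match s with E => 0 | N => 1 | D => 1 end.

(* A lattice path from (0,0) is the sequence of its steps;
   [endpoint w] is the lattice point it reaches. *)
Definition endpoint (w : seq step) : nat * nat :=
  (\sum_(s <- w) dx s, \sum_(s <- w) dy s).

Definition weakly_above (p : nat * nat) : bool := p.1 <= p.2.
Definition on_diagonal (p : nat * nat) : bool := p.1 == p.2.

(* The vertices of the path are the endpoints of its prefixes. *)
Definition schroder_path (w : seq step) : bool :=
  all (fun i => weakly_above (endpoint (take i w))) (iota 0 (size w).+1).

(* A D-step lies on the line y = x iff it starts there. *)
Definition no_diagonal_D (w : seq step) : bool :=
  all (fun i => (nth N w i == D) ==> ~~ on_diagonal (endpoint (take i w)))
      (iota 0 (size w)).

Definition little_schroder_path (n : nat) (w : seq step) : bool :=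
  [&& endpoint w == (n, n), schroder_path w & no_diagonal_D w].

(* Every step increases x + y, so a path from (0,0) to (n,n) has at most 2n
   steps: bounding the length by 2n excludes no path. *)
Definition little_schroder (n : nat) : nat :=
  #|[set w : (n.*2).-bseq step | little_schroder_path n w]|.

Local Open Scope ring_scope.

(* [z i] stands for z_i, so [z 0] is not used. The component [a i] of the
   multi-index is alpha_(i+1), for 0 <= i <= n - k; as the components add up
   to k, bounding each of them by k excludes no multi-index. *)
Definition partial_bell (F : numFieldType) (n k : nat) (z : nat -> F) : F :=
  \sum_(a : {ffun 'I_(n - k).+1 -> 'I_k.+1} |
         ((\sum_(i < (n - k).+1) a i)%N == k) &&
         ((\sum_(i < (n - k).+1) i.+1 * a i)%N == n))
     n`!%:R / (\prod_(i < (n - k).+1) (a i)`!)%N%:R *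
     \prod_(i < (n - k).+1) (z i.+1 / (i.+1)`!%:R) ^+ a i.

(* Main.v *)
(* Let S be the generating function of the little Schroeder numbers. It is the
   power series with S = 1 - x S + 2 x S^2, so that u = S - 1 satisfies
   u = x (1 + u) (1 + 2 u), and Lagrange inversion suggests
     [x^m] S^k = k/m [u^(m-1)] (1 + u)^(m+k-1) (1 + 2u)^m.
   Take the right-hand side as the definition of a(m, k). The recursion in
   (m, k) that S^k = S^(k-1) (1 - x S + 2 x S^2) imposes is checked directly, and
   by uniqueness of its solution a(., k) * a(., l) = a(., k + l) for the
   convolution product. With R = 2 S - 1 one has R = 1 + x R + x R^2, so
   [x^m] R^d S obeys the first-step recursion for the path suffixes that start
   at height d above the diagonal; at d = 0 this is s_m = a(m, 1). The partial
   Bell polynomial is n!/k! [x^(n-k)] S^k by the multinomial theorem, and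
   expanding 1 + 2u = u + (1 + u) in a(n - k, k) gives the stated sum. *)
Require Import Defs.
From mathcomp Require Import all_boot all_order all_algebra.
From mathcomp Require Import ring lra zify.

Import Order.TTheory GRing.Theory Num.Theory.
Local Open Scope ring_scope.

(** * Coefficients of the powers of the little Schröder series S *)

Definition schroder_pow (m k : nat) : rat :=
  if m is p.+1
  then k%:R / m%:R * ((1 + 'X) ^+ (p + k) * (1 + 'X *+ 2) ^+ m : {poly rat})`_p
  else 1.

Arguments schroder_pow : simpl never.

Lemma schroder_pow0 m : schroder_pow m.+1 0 = 0.
Proof. by rewrite /schroder_pow !mul0r. Qed.

Lemma schroder_pow_rec m k :
  schroder_pow m.+1 k.+1 =
  schroder_pow m.+1 k - schroder_pow m k.+1 + 2 * schroder_pow m k.+2.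
Proof.
case: m => [|p]; rewrite /schroder_pow.
  rewrite -!horner_coef0 !hornerE /= !expr1n -[k.+1]addn1 natrD; lra.
(* [W] is the common factor of the four products in the recursion, so only one coefficient each of
   [F], [V] and [W] remains to be related. *)
set W : {poly rat} := (1 + 'X) ^+ (p + k.+1) * (1 + 'X *+ 2) ^+ p.+1.
have eF : (1 + 'X) ^+ (p.+1 + k) * (1 + 'X *+ 2) ^+ p.+2
    = W * (1 + 'X *+ 2) :> {poly rat}.
  by rewrite /W addSnnS [in LHS]exprSr mulrA.
have eG : (1 + 'X) ^+ (p.+1 + k.+1) * (1 + 'X *+ 2) ^+ p.+2
    = (W * (1 + 'X *+ 2)) * (1 + 'X) :> {poly rat}.
  by rewrite /W addSn !exprSr; ring.
have eD : (1 + 'X) ^+ (p + k.+2) * (1 + 'X *+ 2) ^+ p.+1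
    = W * (1 + 'X) :> {poly rat}.
  by rewrite /W addnS !exprSr; ring.
rewrite eF eG eD.
set F := W * (1 + 'X *+ 2); set V := W * (1 + 'X).
have AB : (F * (1 + 'X))`_p.+1 = F`_p.+1 + F`_p.
  by rewrite mulrDr mulr1 coefD coefMX.
have FV : F`_p = 2 * V`_p - W`_p.
  have -> : F = V *+ 2 - W by rewrite /F /V; ring.
  by rewrite coefB coefMn mulr_natl.
(* The two sides of the recursion differ by a multiple of the coefficient of
   u^(p+1) in u G' - (p+1) G, where G = (1 + u) F; that coefficient is 0. *)
have dG : (F * (1 + 'X))^`() = F *+ (p.+1 + k.+1) + V *+ (2 * p.+2).
  rewrite -eG derivM !deriv_exp !derivD !derivX derivC !add0r.
  rewrite /F /V /W addSn !exprS /=.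
  have distr (R : comNzRingType) (a b u v : R) n q :
      1 * a *+ n * (v * (v * b)) + u * a * ((1 + 1) * (v * b) *+ q)
    = a * (v * b) * v *+ n + a * (v * b) * u *+ (2 * q).
    by rewrite mulrnA !(mulrnAl, mulrnAr); congr (_ *+ _ + _ *+ _); ring.
  exact: distr.
have := congr1 (fun P : {poly rat} => P`_p) dG.
rewrite /= coef_deriv coefD !coefMn AB FV => H.
have {}H : (p.+1)%:R * (F`_p.+1 + (2 * V`_p - W`_p)) =
   (p%:R + k%:R + 2) * (2 * V`_p - W`_p) + 2 * (p%:R + 2) * V`_p.
  rewrite mulr_natl H -[_ *+ (_ + _)]mulr_natl -[_ *+ (2 * _)]mulr_natl natrM.
  congr (_ * _ + _ * _ * _); rewrite -?natrD.
    by congr (_%:R); lia.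
  by congr (_%:R); lia.
move: (F`_p.+1) (V`_p) (W`_p) H => f v w H.
have p1 : p%:R + 1 != 0 :> rat by rewrite natr1 pnatr_eq0.
have p2 : p%:R + 2 != 0 :> rat by rewrite -natrD pnatr_eq0 addn2.
rewrite -[k.+2]addn2 -[k.+1]addn1 -[p.+2]addn2 -[p.+1]addn1 !natrD in H *.
have {H} -> : f = ((p%:R + k%:R + 2) * (2 * v - w) + 2 * (p%:R + 2) * v)
    / (p%:R + 1) - (2 * v - w).
  by rewrite -H mulrAC divff // mul1r addrK.
by field; rewrite p1 p2.
Qed.

(** For fixed l both sides obey [schroder_pow_rec] in (m, k) and agree at m = 0 and at k = 0. The
    recursion raises k when it lowers m, hence the outer induction on m for all k. *)
Lemma schroder_pow_conv m k l :
  \sum_(i < m.+1) schroder_pow i k * schroder_pow (m - i) l =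
  schroder_pow m (k + l).
Proof.
elim: m k => [|m IHm] k; first by rewrite big_ord1 mulr1.
elim: k => [|k IHk].
  rewrite big_ord_recl big1 ?addr0 ?mul1r ?subn0 // => i _.
  by rewrite lift0 schroder_pow0 mul0r.
rewrite addSn schroder_pow_rec -IHk -!addSn -!IHm.
(* The recursion covers positive first indices only; the terms at i = 0 agree because a(0, k) = 1
   for every k. *)
rewrite big_ord_recl [X in X - _ + _]big_ord_recl.
rewrite -!addrA; congr (_ + _).
rewrite mulr_sumr -sumrN -!big_split; apply: eq_bigr => i _.
by rewrite lift0 subSS schroder_pow_rec /=; ring.
Qed.

(* [x^m] (2 S - 1)^d S^k, where S is the little Schroeder series. *)
Fixpoint schroder_suffix (d k m : nat) : rat :=
  if d is e.+1 then 2 * schroder_suffix e k.+1 m - schroder_suffix e k m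
  else schroder_pow m k.

Lemma schroder_suffix0 d k : schroder_suffix d k 0 = 1.
Proof. by elim: d k => //= d IH k; rewrite !IH; ring. Qed.

(** This is R = 1 + x R + x R^2 times R^d S^k; for k = 1 the three terms belong to the first steps
    E, N and D. *)
Lemma schroder_suffix_rec d k m :
  schroder_suffix d.+1 k m.+1 = schroder_suffix d k m.+1
    + schroder_suffix d.+2 k m + schroder_suffix d.+1 k m.
Proof.
elim: d k => [|d IH] k; first by rewrite /= schroder_pow_rec; ring.
by rewrite [LHS]/= -/(schroder_suffix d.+1 _ _) !IH /=; ring.
Qed.

(** S = 1 + x R S: on the diagonal N is the only admissible first step. *)
Lemma schroder_suffix0S m : schroder_suffix 0 1 m.+1 = schroder_suffix 1 1 m.
Proof. by rewrite /= schroder_pow_rec schroder_pow0; ring. Qed.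

(** * Binomial and multinomial expansions *)

Lemma coef_expr1X (R : nzRingType) n i :
  ((1 + 'X : {poly R}) ^+ n)`_i = 'C(n, i)%:R.
Proof.
elim: n i => [|n IH] i; first by rewrite expr0 coef1; case: i.
rewrite exprSr mulrDr mulr1 coefD coefMX !IH.
by case: i => [|i] /=; rewrite ?bin0 ?addr0 // binS natrD.
Qed.

Lemma schroder_pow_sum m k : (0 < m)%N ->
  schroder_pow m k = k%:R *
    \sum_(1 <= j < m.+1)
      j%:R^-1 * 'C(m - 1, j - 1)%:R * 'C(m + k + j - 1, j - 1)%:R.
Proof.
case: m => // p _; rewrite /schroder_pow -mulrA; congr (_ * _).
have -> : 1 + 'X *+ 2 = 'X + (1 + 'X) :> {poly rat} by ring.
rewrite [('X + _) ^+ _]exprDn mulr_sumr coef_sum mulr_sumr big_add1 /= big_mkord.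
(* The term at 0 is u^(p+1), which has no coefficient at u^p; the term at i + 1 becomes the summand
   j = i + 1. *)
rewrite [LHS]big_ord_recl [X in X + _]/= subn0 bin0 mulr1n mulr1.
rewrite coefMXn ltnSn mulr0 add0r.
apply: eq_bigr => i _; rewrite lift0 subSS !subn1 /= addnS /=.
have ip : (i <= p)%N by rewrite -ltnS ltn_ord.
rewrite [in LHS]mulrnAr coefMn mulrCA -exprD coefXnM ltnNge leq_subr /= subKn //.
rewrite coef_expr1X addnS mulrC mulrnAl -mulrnAr mulrC; congr (_ * _).
have : (p.+1%:R * 'C(p, i)%:R = i.+1%:R * 'C(p.+1, i.+1)%:R :> rat).
  by rewrite -!natrM mul_bin_diag.
have n1 : p.+1%:R != 0 :> rat by rewrite pnatr_eq0.
have n2 : i.+1%:R != 0 :> rat by rewrite pnatr_eq0.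
move=> H; apply: (mulfI n1); apply: (mulfI n2).
by rewrite [in LHS]mulrnAr divff // [RHS]mulrCA mulVKf // H.
Qed.

(** Let e(z) be exp(z T) cut off after T^k. Up to T^k, e turns sums into products; the coefficient
    of T^k in the product of the e(y i), expanded term by term, is the left-hand side. *)
Lemma sum_multinomial (F : numFieldType) r (y : 'I_r -> {poly F}) k :
  \sum_(a : {ffun 'I_r -> 'I_k.+1} | (\sum_(i < r) a i)%N == k)
    (\prod_(i < r) (a i)`!)%N%:R^-1 *: \prod_(i < r) y i ^+ a i =
  k`!%:R^-1 *: (\sum_(i < r) y i) ^+ k.
Proof.
pose e (z : {poly F}) : {poly {poly F}} :=
  \poly_(c < k.+1) (c`!%:R^-1 *: z ^+ c).
have coef_e z c : (c <= k)%N -> (e z)`_c = c`!%:R^-1 *: z ^+ c.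
  by move=> ck; rewrite coef_poly ltnS ck.
have e_sum c : (c <= k)%N ->
    (\prod_(i < r) e (y i))`_c = c`!%:R^-1 *: (\sum_(i < r) y i) ^+ c.
  elim/big_rec2: _ c => [|i p q _ IH] c ck.
    rewrite coef1; case: c ck => [|c] _; first by rewrite invr1 scale1r.
    by rewrite expr0n scaler0.
  rewrite coefM addrC exprDn scaler_sumr; apply: eq_bigr => j _.
  have jc : (j <= c)%N by rewrite -ltnS.
  rewrite coef_e ?(leq_trans jc) // IH ?(leq_trans (leq_subr _ _)) //.
  rewrite -scalerAl -scalerAr scalerA [y i ^+ j * _]mulrC -scaler_nat scalerA.
  congr (_ *: _).
  rewrite -(bin_fact jc) !natrM.
  have nz m : m`!%:R != 0 :> F by rewrite pnatr_eq0 -lt0n fact_gt0.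
  have nb : 'C(c, j)%:R != 0 :> F by rewrite pnatr_eq0 -lt0n bin_gt0.
  by field; rewrite !nz nb.
rewrite -e_sum //; under [in RHS]eq_bigr => i _ do rewrite /e poly_def.
rewrite bigA_distr_bigA coef_sum big_mkcond; apply: eq_bigr => a _ /=.
have -> : \prod_(i < r) (((a i)`!%:R^-1 *: y i ^+ a i) *: 'X^(a i))
  = ((\prod_(i < r) (a i)`!)%N%:R^-1 *: \prod_(i < r) y i ^+ a i)
     *: 'X^(\sum_(i < r) a i) :> {poly {poly F}}.
  rewrite scaler_prod natr_prod -prodfV -prodrXr; congr (_ *: _).
  by rewrite scaler_prod.
by rewrite coefZ coefXn eq_sym; case: eqP; rewrite ?mulr1 ?mulr0.
Qed.

(** Cutting S off after x^M does not affect coefficients up to x^M, and there powers follow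
    [schroder_pow_conv]. *)
Lemma coef_exp_schroder_pow M m k : (m <= M)%N ->
  ((\poly_(i < M.+1) schroder_pow i 1) ^+ k)`_m = schroder_pow m k.
Proof.
elim: k m => [|k IH] m mM.
  by rewrite coef1; case: m mM => // m _; rewrite schroder_pow0.
rewrite exprS coefM -[k.+1]add1n -schroder_pow_conv; apply: eq_bigr => i _.
have im : (i <= m)%N by rewrite -ltnS.
by rewrite coef_poly ltnS (leq_trans im) // IH // (leq_trans (leq_subr _ _)).
Qed.

(** * Counting little Schröder paths by their first step *)

(* The current point (x,y) has [y - x = d], and [m] is the height still to be climbed to reach (n,n). *)
Fixpoint valid_suffix (d m : nat) (w : seq step) : bool :=
  match w with
  | [::] => (d == 0)%N && (m == 0)%N
  | E :: w' => (0 < d)%N && valid_suffix d.-1 m w'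
  | N :: w' => (0 < m)%N && valid_suffix d.+1 m.-1 w'
  | D :: w' => [&& 0 < d, 0 < m & valid_suffix d m.-1 w']%N
  end.

(** The conditions on a little Schröder path with the origin moved to (x, y), so that induction on
    the word applies. *)
Definition schroder_from (x y n : nat) (w : seq step) : bool :=
  [&& (x + (endpoint w).1 == n)%N, (y + (endpoint w).2 == n)%N,
      all (fun i => x + (endpoint (take i w)).1
                    <= y + (endpoint (take i w)).2)%N (iota 0 (size w).+1)
    & all (fun i => (nth N w i == D) ==>
                    (x + (endpoint (take i w)).1
                     != y + (endpoint (take i w)).2)%N) (iota 0 (size w))].

Lemma schroder_from_cons x y n s w :
  schroder_from x y n (s :: w) =
  [&& (x <= y)%N, (s == D) ==> (x != y)%N
    & schroder_from (x + dx s) (y + dy s) n w].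
Proof.
have epS i : endpoint (take i.+1 (s :: w)) =
    (dx s + (endpoint (take i w)).1, dy s + (endpoint (take i w)).2)%N.
  by rewrite /endpoint /= !big_cons.
have allS P m : all P (iota 0 m.+1) = P 0%N && all (fun i => P i.+1) (iota 0 m).
  by rewrite /= -[1%N]/(1 + 0)%N iotaDl all_map.
rewrite /schroder_from [in LHS]allS [size (s :: w)]/= [X in [&& _, _, _ & X] = _]allS.
under eq_all => i do rewrite epS /= !addnA.
under [X in [&& _, _, _, _ & X] = _]eq_all => i do rewrite epS /= !addnA.
rewrite /endpoint /= !big_cons !big_nil !addn0 !addnA.
by case: (x <= y)%N; case: ((s == D) ==> _); rewrite /= ?andbF.
Qed.

Lemma step_eqE :
  (((E == N) = false) * ((E == D) = false) * ((N == E) = false) *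
   ((N == D) = false) * ((D == E) = false) * ((D == N) = false))%type.
Proof. by do !split; apply/eqP. Qed.

Lemma schroder_from_valid x y n w : (x <= y)%N ->
  schroder_from x y n w = (y <= n)%N && valid_suffix (y - x) (n - y) w.
Proof.
elim: w x y => [|s w IH] x y xy.
  rewrite /schroder_from /endpoint /= !big_nil !addn0 xy /= andbT.
  by apply/idP/idP; lia.
rewrite schroder_from_cons xy /=.
have below x' y' : ~~ (x' <= y')%N -> schroder_from x' y' n w = false.
  move=> h; rewrite /schroder_from /endpoint /= take0 !big_nil !addn0.
  by rewrite (negbTE h) !andbF.
case: s => /=; rewrite ?addn0 ?addn1 ?step_eqE ?eqxx /=.
- case: (ltnP x y) => h; last by rewrite below -?ltnNge // subn_gt0 ltnNge h andbF.
  by rewrite IH // subnS subn_gt0 h.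
- rewrite IH ?leqW // subSn // subnS subn_gt0.
  by case: (ltngtP y n).
rewrite IH // subSS subnS !subn_gt0 neq_ltn [(y < x)%N]ltnNge xy orbF.
by case: (x < y)%N; case: (ltngtP y n).
Qed.

Lemma little_schroder_path_valid n w :
  little_schroder_path n w = valid_suffix 0 n w.
Proof.
rewrite -[RHS]andTb -[n in RHS]subn0 -(schroder_from_valid 0 0 n w) //.
by rewrite /schroder_from /little_schroder_path -pair_eqE /= -andbA.
Qed.

(** [f] bounds the length of the words and drives the recursion, as neither d nor m decreases at
    every step. *)
Fixpoint valid_suffixes (f d m : nat) : seq (seq step) :=
  if f is f'.+1 then
    (if (d == 0)%N && (m == 0)%N then [:: [::]] else [::]) ++
    (if d is d'.+1 then map (cons E) (valid_suffixes f' d' m) else [::]) ++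
    (if m is m'.+1 then map (cons N) (valid_suffixes f' d.+1 m') else [::]) ++
    (if (d, m) is (_.+1, m'.+1) then map (cons D) (valid_suffixes f' d m') else [::])
  else if (d == 0)%N && (m == 0)%N then [:: [::]] else [::].

Lemma mem_valid_suffixes f d m w :
  (w \in valid_suffixes f d m) = valid_suffix d m w && (size w <= f)%N.
Proof.
have mem_cons s s' (w' : seq step) l :
    (s' :: w' \in map (cons s) l) = (s' == s) && (w' \in l).
  apply/mapP/andP => [[v vl [-> ->]]|[/eqP -> wl]]; first by rewrite eqxx.
  by exists w'.
have mem_nil s l : ([::] \in map (cons s) l) = false by apply/mapP => -[].
have mem_if b s (w' : seq step) : (s :: w' \in if b then [:: [::]] else [::]) = false.
  by case: b.
elim: f d m w => [|f IH] d m [|s w].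
- by rewrite /= andbT; case: ifP.
- by rewrite mem_if andbF.
- by rewrite /= !mem_cat andbT; case: d m => [|d] [|m]; rewrite /= ?mem_nil.
rewrite /= !mem_cat mem_if /=.
by case: d m => [|d] [|m]; rewrite ?in_nil ?mem_cons ?IH; case: s;
  rewrite /= ?step_eqE ?eqxx ?orbF ?andbF ?andbT.
Qed.

Lemma valid_suffixes_uniq f d m : uniq (valid_suffixes f d m).
Proof.
elim: f d m => [|f IH] d m /=; first by case: ifP.
have inj s : injective (cons s : seq step -> seq step) by move=> u v [].
have disj s s' (l l' : seq (seq step)) : s != s' ->
    has [in map (cons s) l] (map (cons s') l') = false.
  move=> ss; apply/hasPn => _ /mapP [v _ ->]; apply/mapP => -[u _ [e _]].
  by rewrite e eqxx in ss.
by case: d m => [|d] [|m]; rewrite /= ?cat_uniq ?map_inj_uniq ?IH ?has_cat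
  ?disj ?step_eqE.
Qed.

(** E and N lower d + 2m by 1 and D lowers it by 2, so the length bound [f] loses no word, and the
    first-step recursion applies. *)
Lemma size_valid_suffixes f d m : (d + m.*2 <= f)%N ->
  (size (valid_suffixes f d m))%:R = schroder_suffix d 1 m.
Proof.
elim: f d m => [|f IH] d m; first by case: d m => [|d] [|m].
case: d m => [|d] [|m] h; rewrite /= ?size_cat ?size_map ?addn0 /=.
- by [].
- by rewrite IH -?schroder_suffix0S //; lia.
- by rewrite IH ?schroder_suffix0 //; lia.
rewrite !natrD !IH
  -?[RHS]/(schroder_suffix d.+1 1 m.+1) ?schroder_suffix_rec ?addrA //; lia.
Qed.

Lemma little_schroderE n : (little_schroder n)%:R = schroder_pow n 1.
Proof.
rewrite -[RHS]/(schroder_suffix 0 1 n) -(@size_valid_suffixes n.*2) //.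
rewrite /little_schroder cardE; congr (_ %:R).
rewrite -(size_map val); apply/perm_size/uniq_perm.
- by rewrite (map_inj_uniq val_inj) enum_uniq.
- exact: valid_suffixes_uniq.
move=> w; rewrite mem_valid_suffixes -little_schroder_path_valid.
apply/mapP/andP => [[u]|[wP sw]].
  by rewrite mem_enum inE => uP ->; split=> //; exact: size_bseq.
by exists (Bseq sw); rewrite // mem_enum inE.
Qed.

Theorem theorem2p2 (n k : nat) (k_ge1 : (1 <= k)%N) (k_lt_n : (k < n)%N) :
  partial_bell n k (fun i : nat => i`!%:R * (little_schroder i.-1)%:R) =
  n`!%:R / (k.-1)`!%:R *
  \sum_(1 <= j < (n - k).+1)
     j%:R^-1 * 'C(n - k - 1, j - 1)%:R * 'C(n + j - 1, j - 1)%:R :> rat.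
Proof.
have fact_neq0 i : i`!%:R != 0 :> rat by rewrite pnatr_eq0 -lt0n fact_gt0.
pose m := (n - k)%N; have mk : (m + k = n)%N by rewrite subnK // ltnW.
pose y (i : 'I_m.+1) : {poly rat} := schroder_pow i 1 *: 'X^i.
transitivity (n`!%:R * (\sum_(a : {ffun 'I_m.+1 -> 'I_k.+1} |
    (\sum_(i < m.+1) a i)%N == k)
    (\prod_(i < m.+1) (a i)`!)%N%:R^-1 *: \prod_(i < m.+1) y i ^+ a i)`_m).
  rewrite /partial_bell -/m coef_sum mulr_sumr big_mkcondr.
  apply: eq_bigr => a /eqP ak.
  (* Subtracting the condition that the components sum to k leaves total weight m = n - k, which
     extracting the coefficient of x^m enforces. *)
  have -> : (\sum_(i < m.+1) i.+1 * a i == n)%N = (m == \sum_(i < m.+1) i * a i)%N.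
    under eq_bigr => i _ do rewrite mulSn.
    by rewrite big_split /= ak -mk addnC eqn_add2r eq_sym.
  have -> : \prod_(i < m.+1) y i ^+ a i = (\prod_(i < m.+1) schroder_pow i 1 ^+ a i)
      *: 'X^(\sum_(i < m.+1) i * a i).
    rewrite -prodrXr -scaler_prod; apply: eq_bigr => i _.
    by rewrite exprZn exprM.
  rewrite !coefZ coefXn; case: eqP => _; last by rewrite !mulr0.
  rewrite mulr1 mulrA; congr (_ * _); apply: eq_bigr => i _.
  by rewrite mulrC mulKf // little_schroderE.
have yE : \sum_(i < m.+1) y i = \poly_(i < m.+1) schroder_pow i 1 by rewrite poly_def.
rewrite sum_multinomial coefZ yE coef_exp_schroder_pow //.
rewrite schroder_pow_sum ?subn_gt0 // mk !mulrA; congr (_ * _).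
have kfactE : k`!%:R = k%:R * (k.-1)`!%:R :> rat.
  by rewrite -natrM -[in LHS](prednK k_ge1) factS prednK.
have k_neq0 : k%:R != 0 :> rat by rewrite pnatr_eq0 -lt0n.
by rewrite kfactE; field; rewrite k_neq0 fact_neq0.
Qed.
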